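(* Let $\mathcal{A}$ be a finite-dimensional operator algebra. Then $C^*_{\max}(\mathcal{A})$ is RFD.
   Context: An operator algebra is a norm closed subalgebra of $B(\mathfrak{H})$ for some complex Hilbert space $\mathfrak{H}$ (not necessarily unital or self-adjoint). A $C^*$-algebra $\mathfrak{A}$ is residually finite-dimensional (RFD) if it admits a separating family of finite-dimensional $*$-representations, i.e. an injective $*$-homomorphism into a product $\prod_{\lambda}\mathbb{M}_{r_\lambda}$ of matrix algebras (bounded families, supremum norm). The maximal $C^*$-cover of $\mathcal{A}$ is the essentially unique pair $(C^*_{\max}(\mathcal{A}),\mu)$ where $C^*_{\max}(\mathcal{A})$ is a $C^*$-algebra and $\mu:\mathcal{A}\to C^*_{\max}(\mathcal{A})$ is a completely isometric homomorphism with $C^*(\mu(\mathcal{A}))=C^*_{\max}(\mathcal{A})$, such that for every completely contractive homomorphism $\phi:\mathcal{A}\to B(\mathfrak{H}_\phi)$ there is a $*$-homomorphism $\pi_\phi:C^*_{\max}(\mathcal{A})\to B(\mathfrak{H}_\phi)$ with $\pi_\phi\circ\mu=\phi$. *)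

(* Defs.v *)
From HB Require Import structures.
From mathcomp Require Import all_boot all_order all_algebra.
From mathcomp Require Import sesquilinear complex.
From mathcomp Require Import boolp classical_sets functions reals.
From mathcomp Require Import topology normedtype.

Set Implicit Arguments.
Unset Strict Implicit.
Unset Printing Implicit Defensive.

Import Order.TTheory GRing.Theory Num.Theory.
Import numFieldNormedType.Exports.
Local Open Scope classical_set_scope.
Local Open Scope ring_scope.
Local Open Scope complex_scope.

(* Complex Hilbert spaces; [hdot] is linear in its first argument and
   conjugate-linear in its second one. *)
Record hilbert (R : realType) := Hilbert {
  hcarrier :> completeNormedModType R[i] ;
  hdot : {dot hcarrier for (@Num.conj R[i])} ;
  hdot_norm : forall x : hcarrier, hdot x x = `|x| ^+ 2
}.

Section Operators.
Variable R : realType.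
Implicit Types H K L : hilbert R.

(* The library norm of a complex normed module lives in R[i]; this is the same
   number, as a real. *)
Definition hnorm H (x : H) : R := complex.Re `|x|.

(* Operators are plain functions, with the pointwise vector space structure;
   B(H) is the set of functions satisfying [bounded_op]. *)
Definition bounded_op H K (T : H -> K) : Prop :=
  linear T /\ exists M : R, forall x, hnorm (T x) <= M * hnorm x.

Definition opnorm H K (T : H -> K) : R :=
  sup [set hnorm (T x) | x in [set x : H | hnorm x <= 1]].

Definition is_adjoint H (T S : H -> H) : Prop :=
  forall x y, hdot H (T x) y = hdot H x (S y).

(* The norm of a matrix of operators acting on the Hilbert space direct sum of
   n copies of H. *)
Definition mxopnorm H n (T : 'M[H -> H]_n) : R :=
  sup [set Num.sqrt (\sum_i hnorm (\sum_j T i j (x j)) ^+ 2)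
      | x in [set x : 'I_n -> H | \sum_j hnorm (x j) ^+ 2 <= 1]].

Definition norm_closed H (A : set (H -> H)) : Prop :=
  forall T, bounded_op T ->
    (forall e : R, 0 < e -> exists2 S, A S & opnorm (T - S) < e) -> A T.

Record operator_algebra H (A : set (H -> H)) : Prop := OperatorAlgebra {
  opalg_bounded : forall T, A T -> bounded_op T ;
  opalg0 : A 0 ;
  opalgD : forall S T, A S -> A T -> A (S + T) ;
  opalgZ : forall (a : R[i]) T, A T -> A (a *: T) ;
  opalgM : forall S T, A S -> A T -> A (S \o T) ;
  opalg_closed : norm_closed A
}.

Definition finite_dimensional H (A : set (H -> H)) : Prop :=
  exists (n : nat) (b : 'I_n -> H -> H), (forall i, A (b i)) /\
    forall T, A T -> exists c : 'I_n -> R[i], T = \sum_i c i *: b i.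

(* C*-algebras are taken in concrete form. Adjoints being unique, the second
   clause says that D contains the adjoint of each of its elements. *)
Definition cstar_algebra H (D : set (H -> H)) : Prop :=
  operator_algebra D /\
  forall T, D T -> exists2 S, D S & is_adjoint T S.

(* Only the values of a homomorphism on its domain A are relevant. *)
Record op_hom H K (A : set (H -> H)) (phi : (H -> H) -> K -> K) : Prop :=
  OpHom {
    op_hom_bounded : forall T, A T -> bounded_op (phi T) ;
    op_homD : forall S T, A S -> A T -> phi (S + T) = phi S + phi T ;
    op_homZ : forall (a : R[i]) T, A T -> phi (a *: T) = a *: phi T ;
    op_homM : forall S T, A S -> A T -> phi (S \o T) = phi S \o phi T
  }.

Definition completely_contractive H K (A : set (H -> H))
    (phi : (H -> H) -> K -> K) : Prop :=
  forall n (T : 'M[H -> H]_n), (forall i j, A (T i j)) ->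
    mxopnorm (map_mx phi T) <= mxopnorm T.

Definition completely_isometric H K (A : set (H -> H))
    (phi : (H -> H) -> K -> K) : Prop :=
  forall n (T : 'M[H -> H]_n), (forall i j, A (T i j)) ->
    mxopnorm (map_mx phi T) = mxopnorm T.

Definition star_hom H K (D : set (H -> H)) (pi : (H -> H) -> K -> K) : Prop :=
  op_hom D pi /\
  forall S T, D S -> D T -> is_adjoint S T -> is_adjoint (pi S) (pi T).

(* (D, mu) is a maximal C*-cover of A. *)
Record maximal_cstar_cover H (A : set (H -> H)) K (D : set (K -> K))
    (mu : (H -> H) -> K -> K) : Prop := MaximalCstarCover {
  cover_cstar : cstar_algebra D ;
  cover_hom : op_hom A mu ;
  cover_isometric : completely_isometric A mu ;
  cover_generated : D = smallest (@cstar_algebra K) (mu @` A) ;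
  cover_universal : forall L (phi : (H -> H) -> L -> L),
    op_hom A phi -> completely_contractive A phi ->
    exists pi : (K -> K) -> L -> L,
      star_hom D pi /\ forall T, A T -> pi (mu T) = phi T
}.

Record matrix_star_rep H (D : set (H -> H)) r
    (pi : (H -> H) -> 'M[R[i]]_r) : Prop := MatrixStarRep {
  matrix_repD : forall S T, D S -> D T -> pi (S + T) = pi S + pi T ;
  matrix_repZ : forall (a : R[i]) T, D T -> pi (a *: T) = a *: pi T ;
  matrix_repM : forall S T, D S -> D T -> pi (S \o T) = pi S *m pi T ;
  matrix_rep_star : forall S T, D S -> D T -> is_adjoint S T ->
    pi T = map_mx (@Num.conj R[i]) (pi S)^T
}.

(* No boundedness condition on the families (pi l T)_l is needed: each pi l is
   contractive, being a *-homomorphism between C*-algebras. *)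
Definition residually_finite_dimensional H (D : set (H -> H)) : Prop :=
  exists (I : Type) (r : I -> nat)
         (pi : forall l : I, (H -> H) -> 'M[R[i]]_(r l)),
    (forall l, matrix_star_rep D (pi l)) /\
    forall T, D T -> (forall l, pi l T = 0) -> T = 0.

End Operators.

(* Main.v *)
Require Import Defs.
From mathcomp Require Import all_boot all_order all_algebra.
From mathcomp Require Import complex classical_sets reals topology normedtype.
From mathcomp Require Import sequences sesquilinear boolp functions lra ring.

(* Let P be the orthogonal projection of K onto a finite-dimensional subspace
   that is invariant under mu(A). Then a |-> mu(a) P is a completely contractive
   homomorphism of A into B(K), so it extends to a *-homomorphism pi_P of D into
   B(K). Every pi_P(T) maps into the range of P, so pi_P is given by matrices in
   an orthonormal basis of that subspace. As A is finite-dimensional, every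
   finite set of vectors lies in such a subspace. Along the net of these
   subspaces, mu(a) P and its adjoint P mu(a)^* converge strongly to mu(a) and
   mu(a)^*, hence pi_P(T) converges strongly to T for every T in the C*-algebra
   D generated by mu(A), and the pi_P separate the points of D. *)

Set Implicit Arguments.
Unset Strict Implicit.
Unset Printing Implicit Defensive.

Import Order.TTheory GRing.Theory Num.Theory.
Import numFieldNormedType.Exports.
Local Open Scope classical_set_scope.
Local Open Scope ring_scope.
Local Open Scope complex_scope.

(** * Inner product geometry over the reals *)

Section HilbertSpace.
Variables (R : realType) (H : hilbert R).
Implicit Types x y z : H.

(** The real part of the inner product lies in the ordered field [R], so norm estimates become real
    arithmetic. *)
Definition rdot x y : R := complex.Re (hdot H x y).

Lemma hdotC x y : hdot H x y = Num.conj (hdot H y x).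
Proof. by rewrite hermC expr0 mul1r. Qed.

Lemma rdotC x y : rdot x y = rdot y x.
Proof. by rewrite /rdot hdotC; case: (hdot H y x). Qed.

Lemma normE x : `|x| = (hnorm x)%:C.
Proof.
have := normr_ge0 x; rewrite /hnorm; case: `|x| => a b.
by rewrite lecE /= => /andP[/eqP-> _].
Qed.

Lemma hnorm_ge0 x : 0 <= hnorm x.
Proof. by have := normr_ge0 x; rewrite normE lecE => /andP[]. Qed.

Lemma hnorm0 : hnorm (0 : H) = 0.
Proof. by rewrite /hnorm normr0. Qed.

Lemma hnorm_eq0 x : hnorm x = 0 -> x = 0.
Proof. by move=> x0; apply/normr0_eq0; rewrite normE x0. Qed.

Lemma hnorm_opp x : hnorm (- x) = hnorm x.
Proof. by rewrite /hnorm normrN. Qed.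

Lemma ler_hnormD x y : hnorm (x + y) <= hnorm x + hnorm y.
Proof. by rewrite -lecR rmorphD /= -!normE ler_normD. Qed.

Lemma hnorm_sum (I : Type) (s : seq I) (P : pred I) (F : I -> H) :
  hnorm (\sum_(i <- s | P i) F i) <= \sum_(i <- s | P i) hnorm (F i).
Proof.
apply: (big_ind2 (fun (u : H) v => hnorm u <= v)) => //; first by rewrite hnorm0.
by move=> u a v b ua vb; apply: le_trans (ler_hnormD _ _) (lerD ua vb).
Qed.

Lemma hnormZ (a : R[i]) x : hnorm (a *: x) = complex.Re `|a| * hnorm x.
Proof. by rewrite /hnorm normrZ normE normc_def /= mulr0 subr0. Qed.

Lemma Re_norm_real (a : R) : complex.Re `|a%:C| = `|a|.
Proof. by rewrite normc_def /= expr0n /= addr0 sqrtr_sqr. Qed.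

Lemma Re_mulr_real (a : R) (z : R[i]) : complex.Re (a%:C * z) = a * complex.Re z.
Proof. by case: z => u v /=; rewrite mul0r subr0. Qed.

Lemma hnormZr (a : R) x : hnorm (a%:C *: x) = `|a| * hnorm x.
Proof. by rewrite hnormZ Re_norm_real. Qed.

Lemma hnormE x : hnorm x ^+ 2 = rdot x x.
Proof. by rewrite /rdot hdot_norm normE -rmorphXn. Qed.

Lemma rdotDl x y z : rdot (x + y) z = rdot x z + rdot y z.
Proof. by rewrite /rdot linearDl raddfD. Qed.

Lemma rdotDr x y z : rdot x (y + z) = rdot x y + rdot x z.
Proof. by rewrite rdotC rdotDl !(rdotC x). Qed.

Lemma rdotNl x y : rdot (- x) y = - rdot x y.
Proof. by rewrite /rdot linearNl raddfN. Qed.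

Lemma rdotZl (a : R) x y : rdot (a%:C *: x) y = a * rdot x y.
Proof. by rewrite /rdot linearZl_LR /= Re_mulr_real. Qed.

Lemma hnormB_sqr x y :
  hnorm (x - y) ^+ 2 = hnorm x ^+ 2 - 2 * rdot x y + hnorm y ^+ 2.
Proof.
rewrite !hnormE rdotDl !rdotDr !(rdotC _ (- y)) !rdotNl (rdotC y (-y)) rdotNl.
by rewrite (rdotC y x); ring.
Qed.

(** Cauchy-Schwarz: expand the squared norm of [|y| x - |x| y], which is nonnegative, and cancel the
    factor [|x| |y|]. *)
Lemma rdot_le x y : rdot x y <= hnorm x * hnorm y.
Proof.
have [/hnorm_eq0->|x0] := eqVneq (hnorm x) 0.
  by rewrite /rdot linear0l /= hnorm0 mul0r.
have [/hnorm_eq0->|y0] := eqVneq (hnorm y) 0.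
  by rewrite rdotC /rdot linear0l /= hnorm0 mulr0.
have xy : 0 < hnorm x * hnorm y by rewrite mulr_gt0 // lt_def ?x0 ?y0 hnorm_ge0.
rewrite -(ler_pM2l xy).
have := sqr_ge0 (hnorm ((hnorm y)%:C *: x - (hnorm x)%:C *: y)).
rewrite hnormB_sqr rdotZl rdotC rdotZl (rdotC y) !hnormZr !ger0_norm ?hnorm_ge0 //.
by move=> h; nra.
Qed.

Lemma hdot_eql x y : (forall z, hdot H x z = hdot H y z) -> x = y.
Proof.
move=> xy; apply/eqP; rewrite -subr_eq0; apply/eqP/hnorm_eq0/eqP.
by rewrite -sqrf_eq0 hnormE /rdot linearBl /= xy subrr.
Qed.

Lemma hdot_eqr x y : (forall z, hdot H z x = hdot H z y) -> x = y.
Proof. by move=> xy; apply: hdot_eql => z; rewrite hdotC xy -hdotC. Qed.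

End HilbertSpace.

(** * Geometric sequences and completeness *)

Lemma geometric_lt (R : realType) (q C e : R) :
  0 <= q < 1 -> 0 < e -> exists N : nat, q ^+ N * C < e.
Proof.
move=> /andP[q0 q1] e0.
have /cvgr0Pnorm_lt/(_ e e0)[N _ hN] : geometric C q x @[x --> \oo] --> (0:R).
  by apply: cvg_geometric; rewrite ger0_norm.
by exists N; rewrite mulrC; apply: le_lt_trans (ler_norm _) (hN N (leqnn N)).
Qed.

Lemma geometric_le0 (R : realType) (q a C : R) :
  0 <= q < 1 -> (forall N : nat, a <= q ^+ N * C) -> a <= 0.
Proof.
move=> hq ha; rewrite leNgt; apply/negP => /(geometric_lt C hq)[N].
by rewrite ltNge ha.
Qed.

Lemma geometric_cauchy_cvg (R : realType) (H : hilbert R) (u : nat -> H) (q C : R) :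
    0 <= q < 1 -> 0 <= C ->
    (forall n, hnorm (u n.+1 - u n) <= q ^+ n * C) ->
  exists l, forall N, hnorm (l - u N) <= q ^+ N * (C / (1 - q)).
Proof.
move=> hq C0 hu; have /andP[q0 q1] := hq.
have q1' : 0 < 1 - q by rewrite subr_gt0.
(* The factor [1 - q ^+ k] keeps the exact partial geometric sum, so the induction on [k] closes
   with an equality. *)
have hd N k : hnorm (u (N + k)%N - u N) <= q ^+ N * (C / (1 - q)) * (1 - q ^+ k).
  elim: k => [|k IH]; first by rewrite addn0 subrr hnorm0 expr0 subrr mulr0.
  rewrite addnS -[_ - u N](subrKA (u (N + k)%N)).
  apply: le_trans (ler_hnormD _ _) _; apply: le_trans (lerD (hu _) IH) _.
  rewrite le_eqVlt; apply/orP; left; apply/eqP; rewrite exprD exprS; field.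
  by rewrite gt_eqF.
have hd' N n : (N <= n)%N -> hnorm (u n - u N) <= q ^+ N * (C / (1 - q)).
  move=> /subnKC<-; apply: le_trans (hd _ _) _; rewrite ler_piMr //.
    by rewrite mulr_ge0 ?exprn_ge0 // divr_ge0 // ltW.
  by rewrite gerBl exprn_ge0.
have : cvg (u @ \oo).
  apply: cauchy_cvg; apply: cauchy_exP => -[e e']; rewrite ltcE /= => /andP[/eqP-> e0].
  have [N hN] := geometric_lt (C / (1 - q)) hq e0.
  exists (u N); exists N => // n /= Nn.
  rewrite -ball_normE /ball_ /= -normrN opprB normE ltcR.
  exact: le_lt_trans (hd' _ _ Nn) hN.
move=> /cvg_ex[l /cvgrPdist_lt hl]; exists l => N.
apply/ler_addgt0Pr => e e0.
have [|M _ /(_ (maxn M N) (leq_maxl _ _))] := hl e%:C; first by rewrite ltcR.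
rewrite /= normE ltcR => h.
rewrite -[_ - u N](subrKA (u (maxn M N))) [leRHS]addrC.
apply: le_trans (ler_hnormD _ _) _; apply: lerD (ltW h) (hd' _ _ _).
exact: leq_maxr.
Qed.

(** * Bounded operators, adjoints, and contractivity of star homomorphisms *)

Section Operators.
Variable R : realType.
Implicit Types H K : hilbert R.

Section Linear.
Variables (H K : hilbert R) (T : H -> K).
Hypothesis linT : linear T.

Lemma op0 : T 0 = 0.
Proof.
have := linT 1 0 0; rewrite !scale1r addr0 => h.
by apply: (addrI (T 0)); rewrite -h addr0.
Qed.

Lemma opZ a x : T (a *: x) = a *: T x.
Proof. by rewrite -[a *: x]addr0 linT op0 addr0. Qed.

Lemma opD x y : T (x + y) = T x + T y.
Proof. by rewrite -[x in LHS]scale1r linT scale1r. Qed.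

Lemma opN x : T (- x) = - T x.
Proof. by rewrite -scaleN1r opZ scaleN1r. Qed.

Lemma opB x y : T (x - y) = T x - T y.
Proof. by rewrite opD opN. Qed.

Lemma op_sum (I : Type) (s : seq I) (P : pred I) (F : I -> H) :
  T (\sum_(i <- s | P i) F i) = \sum_(i <- s | P i) T (F i).
Proof. by apply: (big_morph T opD op0). Qed.

End Linear.

Lemma opnorm_le H K (T : H -> K) (M : R) :
  0 <= M -> (forall x, hnorm (T x) <= M * hnorm x) -> opnorm T <= M.
Proof.
move=> M0 hT; apply: ge_sup.
  by exists (hnorm (T 0)), 0 => //=; rewrite hnorm0.
move=> _ [x /= x1 <-]; apply: le_trans (hT x) _.
by rewrite ler_piMr.
Qed.

Lemma opnorm_ub H K (T : H -> K) : bounded_op T ->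
  forall x, hnorm (T x) <= opnorm T * hnorm x.
Proof.
move=> [linT [M hM]] x.
have [/hnorm_eq0->|x0] := eqVneq (hnorm x) 0.
  by rewrite op0 // !hnorm0 mulr0.
have xp : 0 < hnorm x by rewrite lt_def x0 hnorm_ge0.
rewrite -ler_pdivrMr // mulrC.
have -> : (hnorm x)^-1 * hnorm (T x) = hnorm (T ((hnorm x)^-1%:C *: x)).
  by rewrite opZ // hnormZr ger0_norm // invr_ge0 ltW.
apply: ub_le_sup.
  (* [M] comes without a sign hypothesis, hence the absolute value. *)
  exists `|M| => _ [y /= y1 <-]; apply: le_trans (hM y) _.
  apply: le_trans (ler_wpM2r (hnorm_ge0 y) (ler_norm M)) _.
  by rewrite ler_piMr.
exists ((hnorm x)^-1%:C *: x) => //=.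
by rewrite hnormZr ger0_norm ?invr_ge0 ?hnorm_ge0 // mulVf.
Qed.

Lemma opnorm_ge0 H K (T : H -> K) : bounded_op T -> 0 <= opnorm T.
Proof.
move=> bT; rewrite leNgt; apply/negP => lt0.
have T0 (x : H) : hnorm (T x) <= 0 * hnorm x.
  apply: le_trans (opnorm_ub bT x) _.
  by rewrite ler_wpM2r ?hnorm_ge0 // ltW.
have : opnorm T = 0.
  rewrite /opnorm (_ : [set _ | _ in _] = [set 0]) ?sup1 //.
  apply/seteqP; split=> [_ [x _ <-]|_ ->] /=.
    by apply/le_anti; rewrite hnorm_ge0 -[leRHS](mul0r (hnorm x)) T0.
  by exists 0; rewrite /= ?hnorm0 // op0 ?hnorm0 //; case: bT.
by move=> h; rewrite h ltxx in lt0.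
Qed.

Section Adjoint.
Variable H : hilbert R.
Implicit Types S T : H -> H.

Lemma is_adjoint_sym S T : is_adjoint S T -> is_adjoint T S.
Proof. by move=> h x y; rewrite hdotC -h -hdotC. Qed.

Lemma is_adjoint_uniq T S S' : is_adjoint T S -> is_adjoint T S' -> S = S'.
Proof.
move=> h h'; apply/funext => x; apply: hdot_eql => y.
by rewrite (is_adjoint_sym h) (is_adjoint_sym h').
Qed.

Lemma is_adjointD S S' T T' :
  is_adjoint S S' -> is_adjoint T T' -> is_adjoint (S + T) (S' + T').
Proof.
move=> hS hT x y; rewrite -[(S + T) x]/(S x + T x) -[(S' + T') y]/(S' y + T' y).
by rewrite linearDl linearDr /= hS hT.
Qed.

Lemma is_adjointZ a S S' :
  is_adjoint S S' -> is_adjoint (a *: S) ((Num.conj a : R[i]) *: S').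
Proof.
move=> hS x y; rewrite -[(a *: S) x]/(a *: S x) -[(_ *: S') y]/(_ *: S' y).
by rewrite linearZl_LR linearZr_LR /= conjCK hS.
Qed.

Lemma is_adjointM S S' T T' :
  is_adjoint S S' -> is_adjoint T T' -> is_adjoint (S \o T) (T' \o S').
Proof. by move=> hS hT x y /=; rewrite hS hT. Qed.

Lemma adjoint_rdot T S x y : is_adjoint T S -> rdot (T x) y = rdot x (S y).
Proof. by move=> h; rewrite /rdot h. Qed.

(** [|S x|^2] is the real part of [<T (S x), x>], hence at most [M |S x| |x|]; divide by [|S x|]. *)
Lemma adjoint_bound T S (M : R) : is_adjoint T S -> 0 <= M ->
  (forall x, hnorm (T x) <= M * hnorm x) -> forall x, hnorm (S x) <= M * hnorm x.
Proof.
move=> h M0 hT x.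
have [->|S0] := eqVneq (hnorm (S x)) 0; first by rewrite mulr_ge0 ?hnorm_ge0.
have Sp : 0 < hnorm (S x) by rewrite lt_def S0 hnorm_ge0.
rewrite -(ler_pM2l Sp) -expr2 hnormE -(adjoint_rdot _ _ h).
apply: le_trans (rdot_le _ _) _; rewrite mulrA [hnorm (S x) * M]mulrC.
by rewrite ler_wpM2r ?hnorm_ge0.
Qed.

End Adjoint.

Section Algebra.
Variables (H : hilbert R) (D : set (H -> H)).
Hypothesis algD : operator_algebra D.

Lemma opalgB S T : D S -> D T -> D (S - T).
Proof.
by move=> hS hT; rewrite -scaleN1r; apply: opalgD => //; apply: opalgZ.
Qed.

(* The Neumann series [sum_(k >= 1) X^k], a quasi-inverse of [X] that exists
   although the algebra need not be unital. *)
Lemma neumann_quasi_inverse X (q : R) : D X -> 0 <= q < 1 ->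
    (forall x, hnorm (X x) <= q * hnorm x) ->
  exists2 S, D S & S = X + (S \o X).
Proof.
move=> DX hq hX; have /andP[q0 q1] := hq.
have q1' : 0 < 1 - q by rewrite subr_gt0.
(* [s N] is the partial sum [X + ... + X^N]; consecutive ones differ by [X^(N+1)], which gives
   pointwise convergence to [S]. *)
pose s N : H -> H := iter N (fun S : H -> H => X + (S \o X)) 0.
have Ds N : D (s N).
  elim: N => [|N IH] /=; first exact: opalg0.
  by apply: opalgD => //; apply: opalgM.
have lins N : linear (s N) by case: (opalg_bounded algD (Ds N)).
have sS N x : s N.+1 x = X x + s N (X x) by [].
have ds N : forall x, hnorm (s N.+1 x - s N x) <= q ^+ N * hnorm x.
  elim: N => [|N IH] x.
    rewrite sS /= subr0 addr0 expr0 mul1r; apply: le_trans (hX x) _.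
    by rewrite ler_piMl ?hnorm_ge0 // ltW.
  rewrite sS (sS N x) opprD addrACA subrr add0r; apply: le_trans (IH _) _.
  by rewrite exprSr -mulrA ler_wpM2l ?exprn_ge0.
have /choice[S hS] x := geometric_cauchy_cvg hq (hnorm_ge0 x) (fun N => ds N x).
(* An identity for [S] holds once its defect is at most [C q^N] for every [N]; linearity and the
   quasi-inverse equation are obtained this way. *)
have le0 (x : H) C : (forall N, hnorm x <= q ^+ N * C) -> x = 0.
  move=> hx; apply: hnorm_eq0; apply/le_anti.
  by rewrite hnorm_ge0 (geometric_le0 hq hx).
have linS : linear S.
  move=> a x y; apply/eqP; rewrite -subr_eq0; apply/eqP.
  apply: (le0 _ (hnorm (a *: x + y) / (1 - q) +
      (complex.Re `|a| * (hnorm x / (1 - q)) + hnorm y / (1 - q)))) => N.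
  have -> : S (a *: x + y) - (a *: S x + S y) =
      (S (a *: x + y) - s N (a *: x + y)) - (a *: (S x - s N x) + (S y - s N y)).
    by rewrite lins scalerBr addrACA -opprD opprB subrKA.
  apply: le_trans (ler_hnormD _ _) _; rewrite mulrDr lerD // hnorm_opp.
  apply: le_trans (ler_hnormD _ _) _; rewrite mulrDr lerD // hnormZ mulrCA.
  by rewrite ler_wpM2l // normc_def /= sqrtr_ge0.
have SE : S = X + (S \o X).
  apply/funext => x; apply/eqP; rewrite -subr_eq0; apply/eqP.
  apply: (le0 _ (hnorm x / (1 - q) + hnorm (X x) / (1 - q))) => N.
  have -> : S x - (X x + S (X x)) = (S x - s N.+1 x) - (S (X x) - s N (X x)).
    by rewrite sS opprB -addrA; congr (_ + _); rewrite !opprD addrA subrK.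
  apply: le_trans (ler_hnormD _ _) _; rewrite mulrDr; apply: lerD; last by rewrite hnorm_opp.
  apply: le_trans (hS _ _) _; rewrite exprS -mulrA ler_piMl ?(ltW q1) //.
  by rewrite mulr_ge0 ?exprn_ge0 // divr_ge0 ?hnorm_ge0 ?(ltW q1').
(* The estimate is uniform on the unit ball, so [S] is a norm limit of the [s N] and lies in the
   closed algebra [D]. *)
exists S => //; apply: (opalg_closed algD).
  split=> //; exists (1 - q)^-1 => x; have := hS x 0%N.
  by rewrite expr0 mul1r subr0 mulrC.
move=> e e0; have [N hN] := geometric_lt (1 - q)^-1 hq e0.
exists (s N) => //; apply: le_lt_trans hN; apply: opnorm_le.
  by rewrite mulr_ge0 ?exprn_ge0 // invr_ge0 ltW.
by move=> x; have := hS x N; rewrite mulrA mulrAC.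
Qed.

End Algebra.

(** If the norm [c] of [pi T] exceeded that of [T], then [T^* T / c^2] would have norm below 1 and
    hence a quasi-inverse in [D]. The image of the latter under [pi] makes [1 - Y] bounded below,
    which forces the norm of [pi T] to be less than [c]. *)
Lemma star_hom_contractive H K (D : set (H -> H)) (pi : (H -> H) -> K -> K) :
    cstar_algebra D -> star_hom D pi ->
  forall T, D T -> opnorm (pi T) <= opnorm T.
Proof.
move=> [algD adjD] [homD starD] T DT; rewrite leNgt; apply/negP => lt_norm.
have [T' DT' adjT] := adjD _ DT.
have bT := opalg_bounded algD DT; have bZ := op_hom_bounded homD DT.
have bZ' := op_hom_bounded homD DT'; have adjZ := starD _ _ DT DT' adjT.
set M := opnorm T in lt_norm; set c := opnorm (pi T) in lt_norm.
have M0 : 0 <= M := opnorm_ge0 bT.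
have c0 : 0 < c := le_lt_trans M0 lt_norm.
pose X := ((c ^- 2)%:C *: (T' \o T) : H -> H).
have DTT : D (T' \o T) by apply: opalgM.
have DX : D X by apply: opalgZ.
have hq : 0 <= (M / c) ^+ 2 < 1.
  rewrite sqr_ge0 /= expr_lt1 ?divr_ge0 ?(ltW c0) //.
  by rewrite ltr_pdivrMr // mul1r.
have hX x : hnorm (X x) <= (M / c) ^+ 2 * hnorm x.
  rewrite /X /= hnormZr ger0_norm ?invr_ge0 ?exprn_ge0 ?(ltW c0) //.
  rewrite exprMn exprVn [M ^+ 2 * _]mulrC -mulrA ler_wpM2l ?invr_ge0 ?exprn_ge0 ?(ltW c0) //.
  rewrite expr2 -mulrA; apply: le_trans (adjoint_bound adjT M0 (opnorm_ub bT) _) _.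
  by rewrite ler_wpM2l // opnorm_ub.
have [S DS SE] := neumann_quasi_inverse algD DX hq hX.
have DSX : D (S \o X) by apply: opalgM.
have [linS [B hB]] := op_hom_bounded homD DS.
pose Y := pi X.
have YE x : Y x = (c ^- 2)%:C *: pi T' (pi T x).
  by rewrite /Y /X (op_homZ homD) // (op_homM homD).
have SY x : pi S x = Y x + pi S (Y x).
  by rewrite {1}SE (op_homD homD) // (op_homM homD).
(* Applying [pi] to the quasi-inverse equation gives [v = (1 + pi S) (v - Y v)], so [B'] is 1 plus a
   bound for [pi S]. *)
have [B' B1 hB'] : exists2 B' : R, 1 <= B' &
    forall v, hnorm v <= B' * hnorm (v - Y v).
  exists (1 + `|B|) => [|v]; first by rewrite lerDl.
  have {1}-> : v = (v - Y v) + pi S (v - Y v).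
    by rewrite opB // (SY v) addrK subrK.
  apply: le_trans (ler_hnormD _ _) _; rewrite mulrDl mul1r lerD2l.
  apply: le_trans (hB _) _; apply: ler_wpM2r; [exact: hnorm_ge0|exact: ler_norm].
(* [|v - Yv|^2 <= |v|^2 - |pi(T)v|^2 / c^2], so that [c] is not the norm of
   [pi T] when [1 - Y] is bounded below. *)
have hv v : hnorm (v - Y v) ^+ 2 <= hnorm v ^+ 2 - hnorm (pi T v) ^+ 2 / c ^+ 2.
  have dotY : rdot v (Y v) = hnorm (pi T v) ^+ 2 / c ^+ 2.
    by rewrite rdotC YE rdotZl rdotC -(adjoint_rdot _ _ adjZ) -hnormE mulrC.
  have nY : hnorm (Y v) <= hnorm (pi T v) / c.
    rewrite YE hnormZr ger0_norm ?invr_ge0 ?exprn_ge0 ?(ltW c0) //.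
    have c2 : 0 <= c ^- 2 by rewrite invr_ge0 exprn_ge0 // ltW.
    apply: le_trans (ler_wpM2l c2 (adjoint_bound adjZ (ltW c0) (opnorm_ub bZ) _)) _.
    rewrite -/c.
    by rewrite le_eqVlt; apply/orP; left; apply/eqP; field; rewrite gt_eqF.
  have nY2 : hnorm (Y v) ^+ 2 <= hnorm (pi T v) ^+ 2 / c ^+ 2.
    by rewrite -expr_div_n ler_sqr ?nnegrE ?hnorm_ge0 // divr_ge0 ?hnorm_ge0 ?(ltW c0).
  rewrite hnormB_sqr dotY; nra.
(* Since [|v - Y v|] is at least [|v| / B'], the estimate [hv] gives
   [|v|^2 / B'^2 <= |v|^2 - |pi T v|^2 / c^2]; solving for [|pi T v|] yields the constant [t],
   strictly below [c]. *)
pose t := c * Num.sqrt (1 - B' ^- 2).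
have B'0 : 0 < B' := lt_le_trans ltr01 B1.
have Bt : 0 <= 1 - B' ^- 2.
  by rewrite subr_ge0 invf_le1 ?exprn_gt0 // exprn_ege1.
have hZ v : hnorm (pi T v) <= t * hnorm v.
  rewrite -ler_sqr ?nnegrE ?mulr_ge0 ?hnorm_ge0 ?sqrtr_ge0 ?(ltW c0) //.
  rewrite !exprMn sqr_sqrtr //.
  have h : hnorm v ^+ 2 <= B' ^+ 2 * (hnorm v ^+ 2 - hnorm (pi T v) ^+ 2 / c ^+ 2).
    apply: le_trans (_ : (B' * hnorm (v - Y v)) ^+ 2 <= _).
      by rewrite ler_sqr ?nnegrE ?mulr_ge0 ?hnorm_ge0 ?(ltW B'0).
    by rewrite exprMn ler_wpM2l ?sqr_ge0.
  have : hnorm v ^+ 2 * B' ^- 2 <= hnorm v ^+ 2 - hnorm (pi T v) ^+ 2 / c ^+ 2.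
    by rewrite ler_pdivrMr ?exprn_gt0 // mulrC.
  rewrite lerBrDl -lerBrDr ler_pdivrMr ?exprn_gt0 // => h'.
  by apply: le_trans h' _; rewrite le_eqVlt; apply/orP; left; apply/eqP; ring.
have : c <= t.
  by apply: opnorm_le hZ; rewrite mulr_ge0 ?sqrtr_ge0 ?(ltW c0).
apply/negP; rewrite -ltNge /t gtr_pMr // -[ltRHS]sqrtr1 ltr_sqrt //.
by rewrite gtrBl invr_gt0 exprn_gt0.
Qed.

End Operators.

(** * Orthonormal families and finite-rank projections *)

Section Orthonormal.
Variables (R : realType) (H : hilbert R).
Implicit Types (x y z : H) (r : nat).

Definition orthonormal_family r (e : 'I_r -> H) : Prop :=
  forall i j, hdot H (e i) (e j) = (i == j)%:R.

(** The orthogonal projection onto the span when [e] is orthonormal; linearity and symmetry hold for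
    every family. *)
Definition oproj r (e : 'I_r -> H) x : H := \sum_i hdot H x (e i) *: e i.

Lemma hdot_suml (I : Type) (s : seq I) (F : I -> H) y :
  hdot H (\sum_(i <- s) F i) y = \sum_(i <- s) hdot H (F i) y.
Proof.
by apply: (big_morph (fun x => hdot H x y)) => [u v|]; rewrite ?linearDl ?linear0l.
Qed.

Lemma hdot_sumr (I : Type) (s : seq I) (F : I -> H) x :
  hdot H x (\sum_(i <- s) F i) = \sum_(i <- s) hdot H x (F i).
Proof.
by apply: (big_morph (hdot H x)) => [u v|]; rewrite ?linearDr ?linear0r.
Qed.

Lemma hdotZl (a : R[i]) x y : hdot H (a *: x) y = a * hdot H x y.
Proof. by rewrite linearZl_LR. Qed.

Lemma hdotZr (a : R[i]) x y : hdot H x (a *: y) = Num.conj a * hdot H x y.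
Proof. by rewrite linearZr_LR. Qed.

Lemma oproj_linear r (e : 'I_r -> H) : linear (oproj e).
Proof.
move=> a x y; rewrite /oproj scaler_sumr -big_split; apply: eq_bigr => i _ /=.
by rewrite linearDl /= hdotZl scalerDl scalerA.
Qed.

Lemma oproj_sym r (e : 'I_r -> H) : is_adjoint (oproj e) (oproj e).
Proof.
move=> x y; rewrite hdot_suml hdot_sumr; apply: eq_bigr => i _.
by rewrite hdotZl hdotZr -hdotC mulrC.
Qed.

Section Projection.
Variables (r : nat) (e : 'I_r -> H).
Hypothesis he : orthonormal_family e.

Lemma oproj_id i : oproj e (e i) = e i.
Proof.
rewrite /oproj (bigD1 i) //= he eqxx scale1r big1 ?addr0 // => j ji.
by rewrite he eq_sym (negbTE ji) scale0r.
Qed.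

Lemma oproj_idem x : oproj e (oproj e x) = oproj e x.
Proof.
rewrite {2 3}/oproj (op_sum (@oproj_linear _ e)); apply: eq_bigr => i _.
by rewrite (opZ (@oproj_linear _ e)) oproj_id.
Qed.

Lemma oproj_contractive x : hnorm (oproj e x) <= hnorm x.
Proof.
have [->|P0] := eqVneq (hnorm (oproj e x)) 0; first exact: hnorm_ge0.
have Pp : 0 < hnorm (oproj e x) by rewrite lt_def P0 hnorm_ge0.
rewrite -(ler_pM2l Pp) -expr2 hnormE -(adjoint_rdot _ _ (oproj_sym e)) oproj_idem.
exact: rdot_le.
Qed.

End Projection.

(** Induction on the list. The last clause expresses that each [e i] lies in the span of [s], as an
    induction principle: properties closed under linear combinations pass from [s] to [e]. *)
Lemma gram_schmidt (s : seq H) : exists r (e : 'I_r -> H),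
  [/\ orthonormal_family e, forall v, v \in s -> oproj e v = v &
    forall V : H -> Prop, V 0 -> (forall a x y, V x -> V y -> V (a *: x + y)) ->
      (forall v, v \in s -> V v) -> forall i, V (e i)].
Proof.
elim: s => [|v s [r [e [he es eV]]]].
  by exists 0%N, (fun _ => 0); split=> [[]|v|V _ _ _ []] //.
pose w := v - oproj e v.
have [w0|w0] := eqVneq (hnorm w) 0.
  exists r, e; split=> // [x|V V0 VD Vs].
    rewrite inE => /predU1P[->|/es //].
    by have /hnorm_eq0/eqP := w0; rewrite subr_eq0 => /eqP.
  by apply: eV => // x xs; apply: Vs; rewrite inE xs orbT.
have wp : 0 < hnorm w by rewrite lt_def w0 hnorm_ge0.
pose u : H := (hnorm w)^-1%:C *: w.
have wE : w = (hnorm w)%:C *: u.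
  by rewrite /u scalerA -rmorphM /= divff // scale1r.
have uu : hdot H u u = 1.
  rewrite hdot_norm normE /u hnormZr ger0_norm ?invr_ge0 ?hnorm_ge0 //.
  by rewrite mulVf // expr1n.
have ue i : hdot H u (e i) = 0.
  by rewrite hdotZl linearBl /= (oproj_sym e) oproj_id // subrr mulr0.
have eu i : hdot H (e i) u = 0 by rewrite hdotC ue rmorph0.
have Pu : oproj e u = 0.
  by rewrite /oproj big1 // => i _; rewrite ue scale0r.
(* The new unit vector is placed at index 0, and the old family is shifted by one. *)
pose e' (i : 'I_r.+1) := if unlift ord0 i is Some j then e j else u.
have e'0 : e' ord0 = u by rewrite /e' unlift_none.
have e'S i : e' (lift ord0 i) = e i by rewrite /e' liftK.
have Pe' x : oproj e' x = hdot H x u *: u + oproj e x.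
  rewrite /oproj big_ord_recl e'0; congr (_ + _).
  by apply: eq_bigr => i _; rewrite e'S.
exists r.+1, e'; split.
- move=> i j; case: (unliftP ord0 i) => [i'|] ->; case: (unliftP ord0 j) => [j'|] ->;
    rewrite ?e'0 ?e'S ?he ?eu ?ue ?uu //.
- move=> x; rewrite inE => /predU1P[->|/es xs]; rewrite Pe'.
    have -> : hdot H v u = (hnorm w)%:C.
      have -> : v = w + oproj e v by rewrite subrK.
      by rewrite linearDl /= (oproj_sym e) Pu linear0r addr0 {1}wE hdotZl uu mulr1.
    by rewrite -wE subrK.
  by rewrite -xs (oproj_sym e) Pu linear0r scale0r add0r xs.
- move=> V V0 VD Vs.
  have Ve i : V (e i) by apply: eV => // x xs; apply: Vs; rewrite inE xs orbT.
  have VZ a x : V x -> V (a *: x) by move=> Vx; rewrite -[_ *: _]addr0; apply: VD.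
  have VA x y : V x -> V y -> V (x + y).
    by move=> Vx Vy; rewrite -[x]scale1r; apply: VD.
  move=> i; case: (unliftP ord0 i) => [j|] ->; rewrite ?e'0 ?e'S //.
  apply: (VZ); apply: (VA); first by apply: Vs; rewrite inE eqxx.
  rewrite -scaleN1r; apply: (VZ); rewrite /oproj.
  by apply: (big_ind V) => [//|y z|k _]; [apply: VA|apply: VZ].
Qed.

End Orthonormal.

(** * Comparison of matrix norms *)

(** The contraction [f] maps the unit ball of the direct sum into the unit ball, so every value in
    the supremum for [S] occurs in the one for [T]. Boundedness of the entries of [T] makes the
    latter a genuine upper bound. *)
Lemma mxopnorm_le (R : realType) (H K : hilbert R) n
    (S : 'M[H -> H]_n) (T : 'M[K -> K]_n) (f : H -> K) :
    (forall i j, bounded_op (T i j)) ->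
    (forall x, hnorm (f x) <= hnorm x) ->
    (forall i (x : 'I_n -> H),
      hnorm (\sum_j S i j (x j)) = hnorm (\sum_j T i j (f (x j)))) ->
  mxopnorm S <= mxopnorm T.
Proof.
move=> bT hf ST; apply: ge_sup.
  exists (Num.sqrt (\sum_i hnorm (\sum_j S i j ((fun=> 0) j)) ^+ 2)), (fun=> 0) => //=.
  by rewrite big1 // => j _; rewrite hnorm0 expr0n.
move=> _ [x /= x1 <-]; apply: ub_le_sup.
  exists (Num.sqrt (\sum_i (\sum_j opnorm (T i j)) ^+ 2)) => _ [y /= y1 <-].
  rewrite ler_sqrt; last by apply: sumr_ge0 => i _; apply: sqr_ge0.
  have y1' j : hnorm (y j) <= 1.
    rewrite -(@ler_sqr _ (hnorm (y j)) 1) ?nnegrE ?hnorm_ge0 // expr1n.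
    apply: le_trans y1; rewrite (bigD1 j) //= lerDl.
    by apply: sumr_ge0 => k _; apply: sqr_ge0.
  apply: ler_sum => i _; rewrite ler_sqr ?nnegrE ?hnorm_ge0 //; last first.
    by apply: sumr_ge0 => j _; apply: opnorm_ge0.
  apply: le_trans (hnorm_sum _ _ _) _; apply: ler_sum => j _.
  apply: le_trans (opnorm_ub (bT i j) _) _.
  by rewrite ler_piMr ?opnorm_ge0.
exists (f \o x) => /=.
  by apply: le_trans x1; apply: ler_sum => j _; rewrite ler_sqr ?nnegrE ?hnorm_ge0.
by congr Num.sqrt; apply: eq_bigr => i _; rewrite ST.
Qed.

(** * Compressions to invariant subspaces and their strong limits *)

Section Compressions.
Variables (R : realType) (H : hilbert R) (A : set (H -> H)).
Hypotheses (algA : operator_algebra A) (finA : finite_dimensional A).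
Variables (K : hilbert R) (D : set (K -> K)) (mu : (H -> H) -> K -> K).
Hypothesis coverD : maximal_cstar_cover A D mu.

Let cstarD : cstar_algebra D. Proof. exact: (cover_cstar coverD). Qed.
Let algD : operator_algebra D. Proof. by case: cstarD. Qed.
Let homA : op_hom A mu. Proof. exact: (cover_hom coverD). Qed.

Let linA a : A a -> linear (mu a).
Proof. by case/(op_hom_bounded homA). Qed.

Let muD a : A a -> D (mu a).
Proof.
move=> Aa; rewrite (cover_generated coverD) => M [_ hM]; apply: hM.
by exists a.
Qed.

(* [pi] extends the compression of [mu] to the invariant subspace spanned by
   [e]; it acts on all of [K], by zero on the orthogonal complement. *)
Record compression r (e : 'I_r -> K) (pi : (K -> K) -> K -> K) : Prop :=
  Compression {
    compr_orthonormal : orthonormal_family e ;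
    compr_hom : star_hom D pi ;
    compr_mu : forall a, A a -> pi (mu a) = mu a \o oproj e ;
    compr_inv : forall a, A a -> forall x,
      oproj e (mu a (oproj e x)) = mu a (oproj e x)
  }.

(** The list [s] and its images under a spanning family [b] of [A] span an invariant subspace, since
    each product [a \o b i] is again in [A]. The compression [phi] is completely contractive because
    [mu] is completely isometric, and universality of the cover gives [pi]. *)
Lemma compression_exists (s : seq K) : exists r (e : 'I_r -> K) pi,
  compression e pi /\ forall v, v \in s -> oproj e v = v.
Proof.
have [n [b [Ab bA]]] := finA.
pose g := s ++ [seq mu (b i) v | v <- s, i <- enum 'I_n].
have [r [e [he eg eV]]] := gram_schmidt g.
have es v : v \in s -> oproj e v = v by move=> vs; apply: eg; rewrite mem_cat vs.
have Psum (a : H -> H) (x : K) : A a -> exists c : 'I_n -> R[i],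
    mu a x = \sum_i c i *: mu (b i) x.
  move=> Aa; have [c aE] := bA _ Aa; exists c.
  (* [mu] is additive only on [A], so membership in [A] is carried along the sum. *)
  rewrite aE; apply: (proj2 (_ : A (\sum_i c i *: b i) /\ _)).
  apply: (big_ind2 (fun S y => A S /\ mu S x = y)) => [|S y S' y' [AS <-] [AS' <-]|i _].
  - have A0 : A 0 by apply: opalg0.
    by split=> //; have := op_homZ homA 0 A0; rewrite !scale0r => ->.
  - by split; [apply: opalgD|rewrite (op_homD homA)].
  - by split; [apply: opalgZ|rewrite (op_homZ homA)].
have inv a : A a -> forall x, oproj e (mu a (oproj e x)) = mu a (oproj e x).
  move=> Aa x; pose V y := oproj e (mu a y) = mu a y.
  have Plin := @oproj_linear _ _ _ e; have alin := linA Aa.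
  have V0 : V 0 by rewrite /V !op0.
  have VD c y z : V y -> V z -> V (c *: y + z).
    by rewrite /V alin Plin => -> ->.
  have VB i v : v \in s -> oproj e (mu (b i) v) = mu (b i) v.
    move=> vs; apply: eg; rewrite mem_cat; apply/orP; right.
    by apply/allpairsP; exists (v, i); rewrite mem_enum.
  have Vs a' v : A a' -> v \in s -> oproj e (mu a' v) = mu a' v.
    move=> Aa' vs; have [c ->] := Psum a' v Aa'.
    rewrite (op_sum Plin); apply: eq_bigr => i _.
    by rewrite (opZ Plin) VB.
  have Vg v : v \in g -> V v.
    rewrite mem_cat => /orP[vs|/allpairsP[[w i] /= [ws _ ->]]]; first exact: Vs.
    rewrite /V; have <- : mu (a \o b i) w = mu a (mu (b i) w) by rewrite (op_homM homA).
    by apply: Vs => //; apply: opalgM.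
  (* The property [V] passes from [g] to the [e i], and then to their combination [oproj e x]. *)
  suff : V (oproj e x) by [].
  have Ve := eV V V0 VD Vg; rewrite /oproj.
  apply: (big_ind V) => // [y z Vy Vz|i _].
    by rewrite -[y]scale1r; apply: VD.
  by rewrite -[_ *: _]addr0; apply: VD.
pose phi a : K -> K := mu a \o oproj e.
have homphi : op_hom A phi.
  split.
  - move=> a Aa; split=> [c x y|]; first by rewrite /phi /= oproj_linear linA.
    exists (opnorm (mu a)) => x.
    apply: le_trans (opnorm_ub (op_hom_bounded homA Aa) _) _.
    by rewrite ler_wpM2l ?oproj_contractive // opnorm_ge0 //; apply: (op_hom_bounded homA).
  - by move=> S T AS AT; rewrite /phi (op_homD homA).
  - by move=> c T AT; rewrite /phi (op_homZ homA).
  - move=> S T AS AT; apply/funext => x.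
    by rewrite /phi (op_homM homA) //= inv.
have ccphi : completely_contractive A phi.
  move=> n' T AT; rewrite -(cover_isometric coverD AT).
  apply: (mxopnorm_le (f := oproj e)).
  - by move=> i j; rewrite mxE; apply: (op_hom_bounded homA).
  - exact: oproj_contractive.
  - by move=> i x; congr hnorm; apply: eq_bigr => j _; rewrite !mxE.
have [pi [hpi pimu]] := cover_universal coverD homphi ccphi.
by exists r, e, pi.
Qed.

(** The universal property prescribes [pi] only on [mu(A)], so the range has to be controlled
    separately before [pi] can be replaced by matrices. *)
Definition invariant_range (T : K -> K) : Prop :=
  forall r (e : 'I_r -> K) pi, compression e pi ->
  forall x, oproj e (pi T x) = pi T x.

(* Strong convergence of the operators [pi T], along the net of compressions
   directed by inclusion of the underlying subspaces, to [T]. *)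
Definition strong_limit (T : K -> K) : Prop :=
  forall (x : K) (eps : R), 0 < eps -> exists s : seq K,
  forall r (e : 'I_r -> K) pi, compression e pi ->
  (forall v, v \in s -> oproj e v = v) -> hnorm (pi T x - T x) <= eps.

Definition approximable T := invariant_range T /\ strong_limit T.

(** A bound independent of the compression; it makes the arguments for products and norm limits
    uniform along the net. *)
Lemma compression_le r (e : 'I_r -> K) pi T x : compression e pi -> D T ->
  hnorm (pi T x) <= opnorm T * hnorm x.
Proof.
move=> ce DT; have [homD _] := compr_hom ce.
apply: le_trans (opnorm_ub (op_hom_bounded homD DT) x) _.
rewrite ler_wpM2r ?hnorm_ge0 //.
exact: star_hom_contractive cstarD (compr_hom ce) _ DT.
Qed.

Lemma approximable0 : approximable 0.
Proof.
have pi0 r (e : 'I_r -> K) pi : compression e pi -> pi 0 = 0.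
  move=> ce; have [homD _] := compr_hom ce.
  by have := op_homZ homD 0 (opalg0 algD); rewrite !scale0r.
split=> [r e pi ce x|x eps eps0].
  by rewrite (pi0 _ _ _ ce) (op0 (@oproj_linear _ _ _ e)).
by exists [::] => r e pi ce _; rewrite (pi0 _ _ _ ce) subrr hnorm0 ltW.
Qed.

Lemma approximableD S T : D S -> D T ->
  approximable S -> approximable T -> approximable (S + T).
Proof.
move=> DS DT [rS lS] [rT lT].
have piD r (e : 'I_r -> K) pi x : compression e pi -> pi (S + T) x = pi S x + pi T x.
  by move=> ce; have [homD _] := compr_hom ce; rewrite (op_homD homD).
split=> [r e pi ce x|x eps eps0].
  by rewrite (piD _ _ _ _ ce) (opD (@oproj_linear _ _ _ e)) rS ?rT.
have eps2 : 0 < eps / 2 by rewrite divr_gt0.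
have [s1 h1] := lS x _ eps2; have [s2 h2] := lT x _ eps2.
exists (s1 ++ s2) => r e pi ce he; rewrite (piD _ _ _ _ ce).
rewrite -[(S + T) x]/(S x + T x) opprD addrACA [eps]splitr.
apply: le_trans (ler_hnormD _ _) _.
apply: lerD; [apply: h1 ce _ => v vs|apply: h2 ce _ => v vs].
  by apply: he; rewrite mem_cat vs.
by apply: he; rewrite mem_cat vs orbT.
Qed.

Lemma approximableZ c T : D T -> approximable T -> approximable (c *: T).
Proof.
move=> DT [rT lT].
have piZ r (e : 'I_r -> K) pi x : compression e pi -> pi (c *: T) x = c *: pi T x.
  by move=> ce; have [homD _] := compr_hom ce; rewrite (op_homZ homD).
split=> [r e pi ce x|x eps eps0].
  by rewrite (piZ _ _ _ _ ce) (opZ (@oproj_linear _ _ _ e)) rT.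
pose k := complex.Re `|c|; have k0 : 0 <= k by rewrite /k normc_def sqrtr_ge0.
have [s h] := lT x (eps / (1 + k)) (divr_gt0 eps0 (ltr_pwDl ltr01 k0)).
exists s => r e pi ce he; rewrite (piZ _ _ _ _ ce) -[(c *: T) x]/(c *: T x).
rewrite -scalerBr hnormZ -/k; apply: le_trans (ler_wpM2l k0 (h _ _ _ ce he)) _.
rewrite mulrA ler_pdivrMr ?ltr_pwDl //; nra.
Qed.

(** [pi S (pi T x) - S (T x)] splits into [pi S (pi T x - T x)], controlled by the uniform bound on
    [pi S], and [pi S (T x) - S (T x)], controlled by strong convergence at [T x]. *)
Lemma approximableM S T : D S -> D T ->
  approximable S -> approximable T -> approximable (S \o T).
Proof.
move=> DS DT [rS lS] [rT lT].
have piM r (e : 'I_r -> K) pi x : compression e pi -> pi (S \o T) x = pi S (pi T x).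
  by move=> ce; have [homD _] := compr_hom ce; rewrite (op_homM homD).
split=> [r e pi ce x|x eps eps0]; first by rewrite (piM _ _ _ _ ce) rS.
have k0 : 0 <= opnorm S by apply/opnorm_ge0/(opalg_bounded algD DS).
have [s1 h1] := lT x (eps / 2 / (1 + opnorm S))
  (divr_gt0 (divr_gt0 eps0 (ltr0Sn _ 1)) (ltr_pwDl ltr01 k0)).
have [s2 h2] := lS (T x) (eps / 2) (divr_gt0 eps0 (ltr0Sn _ 1)).
exists (s1 ++ s2) => r e pi ce he; rewrite (piM _ _ _ _ ce).
have [homD _] := compr_hom ce; have [linS _] := op_hom_bounded homD DS.
rewrite -(subrKA (pi S (T x))) -opB // [eps]splitr.
apply: le_trans (ler_hnormD _ _) _; apply: lerD; last first.
  by apply: h2 ce _ => v vs; apply: he; rewrite mem_cat vs orbT.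
apply: le_trans (compression_le _ ce DS) _.
have {}h1 : hnorm (pi T x - T x) <= eps / 2 / (1 + opnorm S).
  by apply: h1 ce _ => v vs; apply: he; rewrite mem_cat vs.
apply: le_trans (ler_wpM2l k0 h1) _.
rewrite mulrA ler_pdivrMr ?ltr_pwDl //; nra.
Qed.

(** An [eps / 3] argument: contractivity of every [pi] turns norm closeness of [S] to [T] into
    closeness of [pi S x] to [pi T x], uniformly in the compression. *)
Lemma approximable_closed T : D T ->
    (forall eps : R, 0 < eps ->
      exists S, [/\ D S, approximable S & opnorm (T - S) < eps]) ->
  approximable T.
Proof.
move=> DT hT.
have near x (eps : R) : 0 < eps -> exists S, [/\ D S, approximable S,
    hnorm (T x - S x) <= eps & forall r (e : 'I_r -> K) pi, compression e pi ->
      hnorm (pi T x - pi S x) <= eps].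
  move=> eps0; have d0 : 0 < 1 + hnorm x by rewrite ltr_pwDl ?hnorm_ge0.
  have [S [DS aS TS]] := hT _ (divr_gt0 eps0 d0).
  have DTS : D (T - S) by apply: opalgB.
  have TSx : opnorm (T - S) * hnorm x <= eps.
    apply: le_trans (ler_wpM2r (hnorm_ge0 x) (ltW TS)) _.
    by rewrite mulrAC ler_pdivrMr // ler_pM2l // lerDr.
  exists S; split=> // [|r e pi ce].
    by apply: le_trans (opnorm_ub (opalg_bounded algD DTS) x) TSx.
  have [homD _] := compr_hom ce.
  have DNS : D (- S) by rewrite -scaleN1r; apply: opalgZ.
  have -> : pi T x - pi S x = pi (T - S) x.
    rewrite (op_homD homD) // -[in RHS]scaleN1r (op_homZ homD) //.
    by rewrite -[RHS]/(pi T x + (-1) *: pi S x) scaleN1r.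
  exact: le_trans (compression_le _ ce DTS) TSx.
split=> [r e pi ce x|x eps eps0].
  apply/eqP; rewrite -subr_eq0; apply/eqP/hnorm_eq0/le_anti.
  rewrite hnorm_ge0 andbT; apply/ler_addgt0Pr => eps eps0; rewrite add0r.
  have [S [DS [rS _] _ hS]] := near x _ (divr_gt0 eps0 (ltr0Sn _ 1)).
  have -> : oproj e (pi T x) - pi T x =
      oproj e (pi T x - pi S x) - (pi T x - pi S x).
    by rewrite (opB (@oproj_linear _ _ _ e)) rS // opprB addrA subrK.
  apply: le_trans (ler_hnormD _ _) _; rewrite hnorm_opp [eps]splitr.
  apply: lerD; last exact: hS ce.
  exact: le_trans (oproj_contractive (compr_orthonormal ce) _) (hS _ _ _ ce).
have eps3 : 0 < eps / 3 by rewrite divr_gt0.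
have [S [DS [_ lS] TS hS]] := near x _ eps3.
have [s hs] := lS x _ eps3.
exists s => r e pi ce he.
rewrite -(subrKA (pi S x)) -[_ - T x](subrKA (S x)).
have h1 := hS _ _ _ ce; have h2 := hs _ _ _ ce he.
have h3 : hnorm (S x - T x) <= eps / 3 by rewrite -hnorm_opp opprB.
have h4 := ler_hnormD (pi T x - pi S x) (pi S x - S x + (S x - T x)).
have h5 := ler_hnormD (pi S x - S x) (S x - T x).
lra.
Qed.

(** Once [x] lies in the span of [e], [pi (mu a) x] equals [mu a x] exactly. *)
Lemma approximable_mu a : A a -> approximable (mu a).
Proof.
move=> Aa; split=> [r e pi ce x|x eps eps0].
  by rewrite (compr_mu ce) //= (compr_inv ce).
exists [:: x] => r e pi ce he; rewrite (compr_mu ce) //= he ?mem_head //.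
by rewrite subrr hnorm0 ltW.
Qed.

(** [pi] preserves adjoints, so [pi S] is the adjoint of [mu a P], namely [P S], where [P] is
    [oproj e]. The vector to be captured by the subspace is therefore [S x] instead of [x]. *)
Lemma approximable_mu_adjoint a S :
  A a -> D S -> is_adjoint (mu a) S -> approximable S.
Proof.
move=> Aa DS adjS.
have adj r (e : 'I_r -> K) pi : compression e pi ->
    forall x y, hdot K (mu a (oproj e x)) y = hdot K x (pi S y).
  move=> ce x y; have [_ starD] := compr_hom ce.
  by rewrite -(starD _ _ (muD Aa) DS adjS) (compr_mu ce).
split=> [r e pi ce x|x eps eps0].
  apply: hdot_eqr => y.
  by rewrite -(oproj_sym e) -!(adj _ _ _ ce) (oproj_idem (compr_orthonormal ce)).
exists [:: S x] => r e pi ce he; rewrite (_ : pi S x = S x) ?subrr ?hnorm0 ?ltW //.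
apply: hdot_eqr => y.
by rewrite -(adj _ _ _ ce) adjS (oproj_sym e) he ?mem_head.
Qed.

(* The approximable elements with approximable adjoints form a C*-algebra that
   contains the image of [mu]. *)
Lemma cover_approximable T : D T -> approximable T.
Proof.
(* Strong convergence need not pass to adjoints, so approximability of the adjoint is built into the
   set. *)
pose E := [set T | [/\ D T, approximable T &
                       forall S, is_adjoint T S -> approximable S]].
have adjD S T1 : D T1 -> is_adjoint T1 S -> D S.
  move=> DT1 adj1; have [S' DS' adj'] := proj2 cstarD _ DT1.
  by rewrite (is_adjoint_uniq adj1 adj').
have witness T1 : E T1 -> exists S, [/\ D S, is_adjoint T1 S & approximable S].
  move=> [DT1 _ hT1]; have [S DS adjS] := proj2 cstarD _ DT1.
  by exists S; split=> //; apply: hT1.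
have ED T1 : E T1 -> D T1 by case.
have Ea T1 : E T1 -> approximable T1 by case.
have algE : operator_algebra E.
  split.
  - by move=> T1 /ED; apply: opalg_bounded.
  - split; [exact: opalg0|exact: approximable0|move=> S adjS].
    rewrite (_ : S = 0); first exact: approximable0.
    by apply: is_adjoint_uniq adjS _ => x y; rewrite linear0l linear0r.
  - move=> S T1 ES ET; have [S' [DS' adjS aS']] := witness _ ES.
    have [T' [DT' adjT aT']] := witness _ ET.
    have [[DS aS _] [DT1 aT1 _]] := (ES, ET).
    split; [exact: opalgD|exact: approximableD|move=> V adjV].
    rewrite (is_adjoint_uniq adjV (is_adjointD adjS adjT)).
    exact: approximableD.
  - move=> c T1 ET; have [T' [DT' adjT aT']] := witness _ ET.
    have [DT1 aT1 _] := ET.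
    split; [exact: opalgZ|exact: approximableZ|move=> V adjV].
    rewrite (is_adjoint_uniq adjV (is_adjointZ c adjT)).
    exact: approximableZ.
  - move=> S T1 ES ET; have [S' [DS' adjS aS']] := witness _ ES.
    have [T' [DT' adjT aT']] := witness _ ET.
    have [[DS aS _] [DT1 aT1 _]] := (ES, ET).
    split; [exact: opalgM|exact: approximableM|move=> V adjV].
    rewrite (is_adjoint_uniq adjV (is_adjointM adjS adjT)).
    exact: approximableM.
  - move=> T1 bT1 hT1.
    have DT1 : D T1.
      apply: (opalg_closed algD) => // eps /hT1[S /ED DS TS].
      by exists S.
    split=> //.
      apply: approximable_closed => // eps /hT1[S ES TS].
      by exists S; split; [exact: ED|exact: Ea|].
    move=> T' adjT; have DT' := adjD _ _ DT1 adjT.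
    apply: approximable_closed => // eps /hT1[S ES TS].
    have [S' [DS' adjS aS']] := witness _ ES.
    (* The bound on [T1 - S] passes to its adjoint [T' - S'], so the adjoints are approximated in
       norm as well. *)
    exists S'; split=> //; apply: le_lt_trans TS.
    have DTS : D (T1 - S) by apply: opalgB (ED _ ES).
    have bTS := opalg_bounded algD DTS.
    have adjTS : is_adjoint (T1 - S) (T' - S').
      move=> x y; rewrite -[(T1 - S) x]/(T1 x - S x) -[(T' - S') y]/(T' y - S' y).
      by rewrite linearBl linearBr /= adjT adjS.
    apply: opnorm_le (opnorm_ge0 bTS) _.
    exact: adjoint_bound adjTS (opnorm_ge0 bTS) (opnorm_ub bTS).
rewrite (cover_generated coverD) => /(_ E); case=> //; split=> [|_ [a Aa <-]].
  split=> // T1 ET; have [S [DS adjS aS]] := witness _ ET.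
  exists S => //; split=> // T2 adj2.
  by rewrite (is_adjoint_uniq adj2 (is_adjoint_sym adjS)); apply: Ea.
split; [exact: muD|exact: approximable_mu|move=> S adjS].
exact: approximable_mu_adjoint Aa (adjD _ _ (muD Aa) adjS) adjS.
Qed.

Lemma compression_matrix_rep r (e : 'I_r -> K) pi : compression e pi ->
  matrix_star_rep D (fun T => \matrix_(i, j) hdot K (pi T (e j)) (e i)).
Proof.
move=> ce; have [homD starD] := compr_hom ce; split.
- move=> S T DS DT; apply/matrixP => i j; rewrite !mxE (op_homD homD) //.
  by rewrite -[(pi S + pi T) _]/(pi S (e j) + pi T (e j)) linearDl.
- move=> c T DT; apply/matrixP => i j; rewrite !mxE (op_homZ homD) //.
  by rewrite -[(c *: pi T) _]/(c *: pi T (e j)) hdotZl.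
- move=> S T DS DT; apply/matrixP => i j; rewrite !mxE (op_homM homD) //=.
  have [rT _] := cover_approximable DT.
  have [linS _] := op_hom_bounded homD DS.
  (* The range condition lets [pi T (e j)] be expanded in [e], which turns composition into the
     matrix product. *)
  rewrite -(rT _ _ _ ce) (op_sum linS) hdot_suml; apply: eq_bigr => k _.
  by rewrite (opZ linS) hdotZl !mxE mulrC.
- move=> S T DS DT adjST; apply/matrixP => i j; rewrite !mxE.
  by rewrite (starD _ _ DS DT adjST) -hdotC.
Qed.

End Compressions.

(** * The separating family of matrix representations *)

Theorem theorem1p3 (R : realType) (H : hilbert R) (A : set (H -> H))
    (hA : operator_algebra A) (hfin : finite_dimensional A)
    (K : hilbert R) (D : set (K -> K)) (mu : (H -> H) -> K -> K)
    (hmax : maximal_cstar_cover A D mu) :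
  residually_finite_dimensional D.
Proof.
(* The family runs over all compressions at once, the rank being part of the index. *)
pose I := {r : nat & {p : ('I_r -> K) * ((K -> K) -> K -> K) |
                       compression A D mu p.1 p.2}}.
exists I, (fun l : I => projT1 l), (fun (l : I) T =>
  let: (e, pi) := sval (projT2 l) in \matrix_(i, j) hdot K (pi T (e j)) (e i)).
split=> [[r [[e pi] /= ce]]|T DT T0]; first exact: compression_matrix_rep hmax _ _ _ ce.
apply/funext => x; apply: hnorm_eq0; apply/le_anti; rewrite hnorm_ge0 andbT.
apply/ler_addgt0Pr => eps eps0; rewrite add0r.
have [rT lT] := cover_approximable hmax DT.
have [s hs] := lT x eps eps0.
(* The list [s] makes [pi T x] close to [T x]; adding [x] makes [x] itself a combination of the
   [e j]. *)
have [r [e [pi [ce he]]]] := compression_exists hA hfin hmax (x :: s).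
have [homD _] := compr_hom ce; have [linT _] := op_hom_bounded homD DT.
(* A zero matrix only says that [pi T (e j)] is orthogonal to every [e i]; the range condition then
   makes it vanish. *)
have pi0 j : pi T (e j) = 0.
  rewrite -(rT _ _ _ ce) /oproj big1 // => i _.
  have /matrixP/(_ i j) := T0 (existT _ r (exist _ (e, pi) ce)).
  by rewrite !mxE /= => ->; rewrite scale0r.
have : pi T x = 0.
  rewrite -(he x) ?mem_head // /oproj (op_sum linT) big1 // => i _.
  by rewrite (opZ linT) pi0 scaler0.
move=> pix; have := hs r e pi ce; rewrite pix sub0r hnorm_opp; apply=> v vs.
by apply: he; rewrite inE vs orbT.
Qed.
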